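(* Let $\sigma$ be a surjective endomorphism of $(X,\mathcal B,\mu)$ with $\mu$ quasi-invariant, and let $\varphi$ be a positive Markovian function for $(\sigma,\mu)$. Let $\{m_i:i\in\Lambda\}$ ($\Lambda$ finite or countable) be measurable complex-valued functions such that $S_\varphi^*(\sqrt\varphi\,\overline{m_j}m_i)=\delta_{ij}\mathbf 1$ for all $i,j\in\Lambda$ and $\sum_{i\in\Lambda}m_i\mathbb E_\varphi(\overline{m_i}f)=f$ for all $f\in L^2(\mu)$. Then $L^2(\mu)$ is the orthogonal direct sum $$L^2(\mu)=\bigoplus_{i\in\Lambda}m_i\mathcal H_\varphi,\qquad \mathcal H_\varphi=\{\sqrt\varphi\,(f\circ\sigma):f\in L^2(\mu)\}.$$
   Context: $(X,\mathcal B)$ is a standard Borel space and $\mu$ is a non-atomic Borel probability measure on it. A surjective endomorphism is a measurable map $\sigma:X\to X$ that is onto; $(\mu\circ\sigma^{-1})(A)=\mu(\sigma^{-1}(A))$, and $\mu$ is quasi-invariant if $\mu(A)=0\Leftrightarrow\mu(\sigma^{-1}(A))=0$ for $A\in\mathcal B$. Equalities of functions are modulo $\mu$-null sets; $L^2(\mu)$ is complex-valued. A Borel function $\varphi$ is Markovian for $(\sigma,\mu)$ if $\int_X (f\circ\sigma)\varphi\,d\mu=\int_X f\,d\mu$ for all $f\in L^1(\mu)$; positive means $\varphi>0$ a.e. $S_\varphi(f)=\sqrt\varphi\,(f\circ\sigma)$ is an isometry of $L^2(\mu)$ with adjoint $S_\varphi^*(g)=\frac{(g\sqrt\varphi\,d\mu)\circ\sigma^{-1}}{d\mu}$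 (Radon–Nikodym derivative with respect to $\mu$ of $A\mapsto\int_{\sigma^{-1}(A)}g\sqrt\varphi\,d\mu$); the same formula defines $S_\varphi^*(g)$ for every measurable $g$ with $\sqrt\varphi\,g\in L^1(\mu)$ (a condition stated on $S_\varphi^*(g)$ includes this integrability). $\mathbb E_\varphi(g)=S_\varphi S_\varphi^*(g)=\sqrt\varphi\,(S_\varphi^*(g)\circ\sigma)$. $m_i\mathcal H_\varphi=\{m_ih:h\in\mathcal H_\varphi\}$. $\mathbf 1$ is the constant function $1$. *)

(* Defs.v *)
From HB Require Import structures.
From mathcomp Require Import all_boot all_order all_algebra finmap.
From mathcomp Require Import complex.
From mathcomp Require Import all_classical all_reals all_analysis.
(* only for the filter [summability.totally] *)
From mathcomp Require summability.

Set Implicit Arguments.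
Unset Strict Implicit.
Unset Printing Implicit Defensive.

Import Order.TTheory GRing.Theory Num.Theory.
Import numFieldNormedType.Exports.

Local Open Scope classical_set_scope.
Local Open Scope ring_scope.
Local Open Scope complex_scope.

(* A Hausdorff complete pseudo-metric space is a complete metric space, so
   [Y] below is Polish; [<<s @open Y>>] is its Borel sigma-algebra. *)
Definition standard_borel (R : realType) d (X : measurableType d) :=
  exists (Y : completePseudoMetricType R) (f : X -> Y),
    [/\ hausdorff_space Y, @second_countable Y, bijective f &
        forall B : set Y, <<s @open Y >> B <-> measurable (f @^-1` B)].

Definition nonatomic (R : realType) d (X : measurableType d)
    (mu : {measure set X -> \bar R}) :=
  forall A, measurable A -> (0 < mu A)%E ->
    exists B, [/\ measurable B, B `<=` A, (0 < mu B)%E & (mu B < mu A)%E].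

Definition quasi_invariant (R : realType) d (X : measurableType d)
    (mu : {measure set X -> \bar R}) (sigma : X -> X) :=
  forall A, measurable A ->
    mu A = 0%E <-> pushforward mu sigma A = 0%E.

(* [Re] and [Im] are otherwise the projections of a numClosedFieldType *)
Local Notation Re := complex.Re.
Local Notation Im := complex.Im.

Section complex_valued.
Context (R : realType) d (X : measurableType d)
  (mu : {measure set X -> \bar R}).
Implicit Types f g : X -> R[i].

Definition cmeasurable f :=
  measurable_fun setT (fun x => Re (f x)) /\
  measurable_fun setT (fun x => Im (f x)).

Definition cintegrable f :=
  mu.-integrable setT (fun x => (Re (f x))%:E) /\
  mu.-integrable setT (fun x => (Im (f x))%:E).

Definition cintegral f : R[i] :=
  (\int[mu]_x Re (f x)) +i* (\int[mu]_x Im (f x)).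

Definition L2norm f : \bar R := 'N[mu]_2%:E[EFin \o (@Normc.normc R \o f)]%E.

(* Elements of L^2 are represented by functions; equality in L^2 is
   [f = g %[ae mu]]. *)
Definition L2 : set (X -> R[i]) :=
  [set f | cmeasurable f /\ (L2norm f < +oo)%E].

Definition L2dot f g : R[i] := cintegral (fun x => f x * conjc (g x)).

(* unconditional convergence in L^2: [summability.totally] is the filter of
   the finite subsets of [I] directed by inclusion *)
Definition L2_has_sum (I : choiceType) (u : I -> X -> R[i]) f :=
  (fun F : {fset I} => L2norm (fun x => f x - \sum_(i <- F) u i x))
    @ @summability.totally I --> 0%E.

(* Closedness makes [V] stable under a.e. equality of measurable functions. *)
Definition closed_subspace (V : set (X -> R[i])) :=
  [/\ V `<=` L2, V (fun=> 0),
      forall f g, V f -> V g -> V (fun x => f x + g x),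
      forall (c : R[i]) f, V f -> V (fun x => c * f x) &
      forall f, L2 f ->
        (forall e : R, 0 < e ->
           exists2 g, V g & (L2norm (fun x => (f x - g x)%R) < e%:E)%E) -> V f].

Definition L2_orthogonal_direct_sum (I : choiceType)
    (V : I -> set (X -> R[i])) :=
  [/\ forall i, closed_subspace (V i),
      forall i j, i != j -> forall f g, V i f -> V j g -> L2dot f g = 0 &
      forall f, L2 f -> exists h : I -> X -> R[i],
        [/\ forall i, V i (h i), L2_has_sum h f &
            forall h', (forall i, V i (h' i)) -> L2_has_sum h' f ->
              forall i, h' i = h i %[ae mu]]].

End complex_valued.

Section transfer.
Context (R : realType) d (X : measurableType d) (mu : probability X R)
  (sigma : {mfun X >-> X}) (phi : X -> R).
Implicit Types f g : X -> R[i].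

(* the charge A |-> \int_(sigma^-1 A) u dmu *)
Definition pushed_charge (u : X -> R)
    (iu : mu.-integrable setT (EFin \o u)) : {charge set X -> \bar R}.
Proof.
refine [the {charge set X -> \bar R} of
          pushforward (induced_charge iu) sigma].
exact: measurable_funP.
Defined.

Definition RN_pushed (u : X -> R) : X -> R :=
  if pselect (mu.-integrable setT (EFin \o u)) is left iu
  then fine \o Radon_Nikodym (pushed_charge iu) mu
  else cst 0.

Definition sqrt_phi (x : X) : R[i] := (Num.sqrt (phi x))%:C.

Definition markovian :=
  measurable_fun setT phi /\
  forall f, cintegrable mu f ->
    cintegrable mu (fun x => f (sigma x) * (phi x)%:C) /\
    cintegral mu (fun x => f (sigma x) * (phi x)%:C) = cintegral mu f.

Definition S_phi f : X -> R[i] := fun x => sqrt_phi x * f (sigma x).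

(* [g] is in the domain of the formula defining S^* *)
Definition S_phi_adj_dom g := cintegrable mu (fun x => g x * sqrt_phi x).

(* d((g sqrt_phi dmu) o sigma^-1) / dmu, computed on real and imaginary
   parts; only meaningful on [S_phi_adj_dom] *)
Definition S_phi_adj g : X -> R[i] := fun x =>
  RN_pushed (fun y => Re (g y * sqrt_phi y)) x +i*
  RN_pushed (fun y => Im (g y * sqrt_phi y)) x.

Definition E_phi g : X -> R[i] := S_phi (S_phi_adj g).

(* The measurability clauses below are needed because [mu] is not assumed
   complete: a function a.e. equal to a measurable one may fail to be
   measurable. *)
Definition H_phi : set (X -> R[i]) :=
  [set h | cmeasurable h /\ exists2 f, L2 mu f & h = S_phi f %[ae mu]].

Definition mulH (m : X -> R[i]) : set (X -> R[i]) :=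
  [set k | cmeasurable k /\
           exists2 h, H_phi h & k = (fun x => m x * h x) %[ae mu]].

End transfer.

(* Main.v *)
Require Import Defs.
From HB Require Import structures.
From mathcomp Require Import all_boot all_order all_algebra finmap.
From mathcomp Require Import complex.
From mathcomp Require Import all_classical all_reals all_analysis.
From mathcomp Require Import measurable_realfun ring lra.

(** Write s = sqrt phi and T_i f = m_i s (f o sigma), so that m_i H_phi is the
range of T_i.  The hypothesis on the pairs (i, j) says that the complex measure
of density m_i (conj m_j) s^2 with respect to mu is pushed by sigma to
delta_ij mu.  Integrating F o sigma against that density therefore gives
delta_ij times the integral of F.  With F = |f|^2 and i = j this makes T_i an
isometry of L^2; with F = f (conj g) and i <> j it makes the ranges of T_i and
T_j orthogonal.  This change of variables is [integral_comp_density], with the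
nonnegative version [ge0_integral_comp_density].

The expansion of f supplied by the second hypothesis has terms
m_i E_phi (conj m_i f) = T_i g with g = S^* (conj m_i f), and these terms lie in
m_i H_phi once g is known to be square integrable.  As g is only given as a
Radon-Nikodym density, this is proved by testing it against its own truncations
([pushed_density_energy_le]); it amounts to the contractivity of the adjoint of
the isometry T_i.

What remains is a fact on a family (V_i) of mutually orthogonal linear subspaces
of L^2 such that every f is a sum of components h_i in V_i: the V_i are then
closed and the components are unique
([L2_orthogonal_direct_sum_of_expansion]).  Both follow from the observation
that two finite sums of components that are close have close components
([energy_componentB_le]).  For uniqueness, apply it to two expansions of f.  For
closedness, apply it to an expansion of f and to an element g of V_i close to f,
seen as a sum with a single component: h_i is close to g, thus to f, so that
f = h_i. *)

Set Implicit Arguments.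
Unset Strict Implicit.
Unset Printing Implicit Defensive.

Import Order.TTheory GRing.Theory Num.Theory.
Import numFieldNormedType.Exports.

Local Open Scope classical_set_scope.
Local Open Scope ring_scope.
Local Open Scope complex_scope.

Local Notation Re := complex.Re.
Local Notation Im := complex.Im.

(** * Measures with a density *)

Section density.
Local Open Scope ereal_scope.
Context d (X : measurableType d) (R : realType).
Variables (mu : {measure set X -> \bar R}) (u : X -> R).
Hypotheses (mu_u : measurable_fun setT u) (u0 : forall x, (0 <= u x)%R).

(** The measure u mu.  The two proofs are arguments so that the measure structure
can be inferred from the term itself. *)
Definition density of measurable_fun setT u & (forall x, (0 <= u x)%R) :=
  fun A => \int[mu]_(x in A) (u x)%:E.

Local Notation nu := (density mu_u u0).

Let nu0 : nu set0 = 0. Proof. exact: integral_set0. Qed.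

Let nu_ge0 A : 0 <= nu A.
Proof. by apply: integral_ge0 => x _; rewrite lee_fin. Qed.

Let nu_sigma_additive : semi_sigma_additive nu.
Proof.
apply: semi_sigma_additive_nng_induced; first exact/measurable_EFinP.
by move=> x; rewrite lee_fin.
Qed.

HB.instance Definition _ :=
  isMeasure.Build _ _ _ nu nu0 nu_ge0 nu_sigma_additive.

Import HBNNSimple.

Let integral_density_nnsfun (h : {nnsfun X >-> R}) :
  \int[nu]_x (h x)%:E = \int[mu]_x (h x * u x)%:E.
Proof.
rewrite integralT_nnsfun sintegralE.
transitivity (\int[mu]_x \sum_(y \in range h)
    (y%:E * (\1_(h @^-1` [set y]) x * u x)%:E)).
  rewrite ge0_integral_fsum//; last 2 first.
  - move=> y; apply: emeasurable_funM => //.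
    exact/measurable_EFinP/measurable_funM.
  - move=> y x _; rewrite -EFinM lee_fin mulrA mulr_ge0//.
    exact: nnfun_muleindic_ge0.
  apply: eq_fsbigr => y /[!inE] -[z _ <-].
  rewrite ge0_integralZl//; last 3 first.
  - exact/measurable_EFinP/measurable_funM.
  - by move=> x _; rewrite lee_fin mulr_ge0.
  - by rewrite lee_fin.
  congr (_ * _); rewrite [LHS]integral_mkcond; apply: eq_integral => x _.
  by rewrite /patch indicE; case: ifPn => _; rewrite ?mul1r ?mul0r.
apply: eq_integral => x _; rewrite fimfunE; under eq_fsbigr do rewrite -EFinM.
rewrite fsumEFin//; congr EFin; rewrite mulr_fsuml.
by apply: eq_fsbigr => y _; rewrite mulrA.
Qed.

(** Monotone convergence reduces the formula to simple functions, where it is the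
definition of the measure. *)
Lemma ge0_integral_density (b : X -> \bar R) :
  measurable_fun setT b -> (forall x, 0 <= b x) ->
  \int[nu]_x b x = \int[mu]_x (b x * (u x)%:E).
Proof.
move=> mb b0.
pose b_ := nnsfun_approx measurableT mb.
have cvb x : EFin \o b_^~ x @ \oo --> b x.
  by apply: cvg_nnsfun_approx => // y _.
transitivity (limn (fun n => \int[nu]_x (b_ n x)%:E)).
  rewrite -monotone_convergence//.
  - by apply: eq_integral => x _; apply/esym/cvg_lim => //; exact: cvb.
  - by move=> n; exact/measurable_EFinP.
  - by move=> n x _; rewrite lee_fin.
  - by move=> x _ m n mn; rewrite lee_fin; exact/lefP/nd_nnsfun_approx.
under [in LHS]eq_fun do rewrite integral_density_nnsfun.
rewrite -monotone_convergence//.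
- apply: eq_integral => x _; apply/cvg_lim => //.
  under eq_fun do rewrite EFinM.
  by apply: cvgeZr => //; exact: cvb.
- by move=> n; apply/measurable_EFinP/measurable_funM.
- by move=> n x _; rewrite lee_fin mulr_ge0.
- move=> x _ m n mn; rewrite lee_fin ler_wpM2r//.
  exact/lefP/nd_nnsfun_approx.
Qed.

End density.

(** * Change of variables along a map that pushes one density to another *)

Section positive_negative_parts.
Local Open Scope ereal_scope.
Context d (X : measurableType d) (R : realType) (mu : {measure set X -> \bar R}).

Lemma integral_funrposneg (u : X -> R) D :
  measurable D -> mu.-integrable D (EFin \o u) ->
  [/\ \int[mu]_(x in D) (u^\+%R x)%:E \is a fin_num,
      \int[mu]_(x in D) (u^\-%R x)%:E \is a fin_num &
      \int[mu]_(x in D) (u x)%:E =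
      \int[mu]_(x in D) (u^\+%R x)%:E - \int[mu]_(x in D) (u^\-%R x)%:E].
Proof.
move=> mD iu.
have ip := integrable_funrpos mD iu; have im := integrable_funrneg mD iu.
split; [exact: integrable_fin_num|exact: integrable_fin_num|].
rewrite -integralB//; apply: eq_integral => x _.
by rewrite -EFinB -[in LHS](funrposBneg u).
Qed.

Lemma integral_ge0_mul_funrposneg (c u : X -> R) :
  (forall x, (0 <= c x)%R) -> mu.-integrable setT (fun x => (c x * u x)%:E) ->
  [/\ \int[mu]_x (c x * u^\+%R x)%:E \is a fin_num,
      \int[mu]_x (c x * u^\-%R x)%:E \is a fin_num &
      \int[mu]_x (c x * u x)%:E =
      \int[mu]_x (c x * u^\+%R x)%:E - \int[mu]_x (c x * u^\-%R x)%:E].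
Proof.
move=> c0 icu; have := integral_funrposneg measurableT icu.
rewrite (_ : (fun x => c x * u x)^\+ = fun x => c x * u^\+ x)%R; last first.
  by apply/funext => x; rewrite /funrpos/= maxr_pMr// mulr0.
rewrite (_ : (fun x => c x * u x)^\- = fun x => c x * u^\- x)%R//.
by apply/funext => x; rewrite /funrneg/= maxr_pMr// mulr0 mulrN.
Qed.

Lemma integrable_mul_le (c c' u : X -> R) :
  measurable_fun setT c' -> measurable_fun setT u ->
  (forall x, (`|c' x| <= `|c x|)%R) ->
  mu.-integrable setT (fun x => (c x * u x)%:E) ->
  mu.-integrable setT (fun x => (c' x * u x)%:E).
Proof.
move=> mc' mu_u cc'; apply: le_integrable => //.
  exact/measurable_EFinP/measurable_funM.
by move=> x _; rewrite lee_fin !normrM ler_wpM2r.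
Qed.

Lemma normr_funrpos_le (c : X -> R) x : (`|c^\+%R x| <= `|c x|)%R.
Proof.
by rewrite ger0_norm ?funrpos_ge0// ge_max ler_norm normr_ge0.
Qed.

Lemma normr_funrneg_le (c : X -> R) x : (`|c^\-%R x| <= `|c x|)%R.
Proof.
rewrite ger0_norm ?funrneg_ge0// ge_max normr_ge0 andbT.
by rewrite -normrN ler_norm.
Qed.

Lemma integral_mul_funrposneg (c u : X -> R) :
  measurable_fun setT c -> measurable_fun setT u ->
  mu.-integrable setT (fun x => (c x * u x)%:E) ->
  \int[mu]_x (c x * u x)%:E =
    \int[mu]_x (c^\+%R x * u x)%:E - \int[mu]_x (c^\-%R x * u x)%:E.
Proof.
move=> mc mu_u icu; rewrite -integralB//.
- apply: eq_integral => x _.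
  by rewrite -EFinB -mulrBl -[in LHS](funrposBneg c).
- apply: (integrable_mul_le _ mu_u (normr_funrpos_le c) icu).
  exact: measurable_funrpos.
- apply: (integrable_mul_le _ mu_u (normr_funrneg_le c) icu).
  exact: measurable_funrneg.
Qed.

End positive_negative_parts.

Section change_of_variables.
Local Open Scope ereal_scope.
Context d d' (X : measurableType d) (Y : measurableType d') (R : realType).
Variables (mu : {measure set X -> \bar R}) (nu : {measure set Y -> \bar R}).
Variables (sigma : X -> Y) (w : X -> R) (a : Y -> R).
Hypothesis msigma : measurable_fun setT sigma.

(** If sigma pushes w mu to a nu on measurable sets, then it does so on nonnegative
functions, because the two measures coincide. *)
Lemma ge0_integral_comp_density (b : Y -> \bar R) :
  measurable_fun setT w -> (forall x, (0 <= w x)%R) ->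
  measurable_fun setT a -> (forall y, (0 <= a y)%R) ->
  (forall B, measurable B ->
    \int[mu]_(x in sigma @^-1` B) (w x)%:E = \int[nu]_(y in B) (a y)%:E) ->
  measurable_fun setT b -> (forall y, 0 <= b y) ->
  \int[mu]_x (b (sigma x) * (w x)%:E) = \int[nu]_y (b y * (a y)%:E).
Proof.
move=> mw w0 ma a0 wa mb b0.
rewrite -(ge0_integral_density _ mw w0 (measurableT_comp mb msigma)
  (fun x => b0 (sigma x))).
rewrite -(ge0_integral_density _ ma a0 mb)//.
have := ge0_integral_pushforward msigma (density mu mw w0) measurableT mb
  (fun y _ => b0 y).
rewrite preimage_setT => <-.
by apply: eq_measure_integral => B mB _; exact: wa.
Qed.

Hypotheses (iw : mu.-integrable setT (EFin \o w))
  (ia : nu.-integrable setT (EFin \o a)).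
Hypothesis wa : forall B, measurable B ->
    \int[mu]_(x in sigma @^-1` B) (w x)%:E = \int[nu]_(y in B) (a y)%:E.

Let mw : measurable_fun setT w.
Proof. by apply/measurable_EFinP; exact: measurable_int iw. Qed.

Let ma : measurable_fun setT a.
Proof. by apply/measurable_EFinP; exact: measurable_int ia. Qed.

(* For signed w and a, moving the negative parts across the equality [wa] yields
   two equal measures a^+ nu + sigma_*(w^- mu) and a^- nu + sigma_*(w^+ mu). *)
Let cross_eq (b : Y -> R) :
  measurable_fun setT b -> (forall y, (0 <= b y)%R) ->
  \int[nu]_y (b y * a^\+%R y)%:E + \int[mu]_x (b (sigma x) * w^\-%R x)%:E =
  \int[nu]_y (b y * a^\-%R y)%:E + \int[mu]_x (b (sigma x) * w^\+%R x)%:E.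
Proof.
move=> mb b0.
have [mpa mna] := (measurable_funrpos ma, measurable_funrneg ma).
have [mpw mnw] := (measurable_funrpos mw, measurable_funrneg mw).
have mbE : measurable_fun setT (EFin \o b) by exact/measurable_EFinP.
have bE0 y : 0 <= (b y)%:E by rewrite lee_fin.
have pw : forall (u : X -> R) (mu_u : measurable_fun setT u)
    (u0 : forall x, (0 <= u x)%R),
    \int[mu]_x (b (sigma x) * u x)%:E =
    \int[pushforward (density mu mu_u u0) sigma]_y (b y)%:E.
  move=> u mu_u u0.
  have := ge0_integral_pushforward msigma (density mu mu_u u0) measurableT mbE
    (fun y _ => bE0 y).
  rewrite preimage_setT => ->.
  by rewrite (ge0_integral_density _ mu_u u0 (measurableT_comp mbE msigma)
    (fun x => bE0 (sigma x))).
have pa : forall (u : Y -> R) (mu_u : measurable_fun setT u)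
    (u0 : forall x, (0 <= u x)%R),
    \int[nu]_x (b x * u x)%:E = \int[density nu mu_u u0]_y (b y)%:E.
  by move=> u mu_u u0; rewrite ge0_integral_density.
rewrite (pa _ mpa (funrpos_ge0 a)) (pa _ mna (funrneg_ge0 a)).
rewrite (pw _ mpw (funrpos_ge0 w)) (pw _ mnw (funrneg_ge0 w)).
rewrite -ge0_integral_measure_add// -ge0_integral_measure_add//.
apply: eq_measure_integral => B mB _.
rewrite [LHS]measure_addE [RHS]measure_addE /= /density /pushforward/=.
have mSB : measurable (sigma @^-1` B).
  by rewrite -[X in measurable X]setTI; exact: msigma.
have [wpf wnf wE] :=
  integral_funrposneg mSB (integrableS measurableT mSB (@subsetT _ _) iw).
have [apf anf aE] :=
  integral_funrposneg mB (integrableS measurableT mB (@subsetT _ _) ia).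
have := wa mB; rewrite wE aE.
move: wpf wnf apf anf; do 4 move=> /fineK <-.
by rewrite -!EFinB -!EFinD => -[] ?; congr EFin; lra.
Qed.

Let integral_comp_density_ge0 (b : Y -> R) :
  measurable_fun setT b -> (forall y, (0 <= b y)%R) ->
  mu.-integrable setT (fun x => (b (sigma x) * w x)%:E) ->
  nu.-integrable setT (fun y => (b y * a y)%:E) ->
  \int[mu]_x (b (sigma x) * w x)%:E = \int[nu]_y (b y * a y)%:E.
Proof.
move=> mb b0 ibw iba.
have [wpf wnf wE] :=
  integral_ge0_mul_funrposneg (fun x => b0 (sigma x)) ibw.
have [apf anf aE] := integral_ge0_mul_funrposneg b0 iba.
have := cross_eq mb b0; move: wE aE => /= -> ->.
move: wpf wnf apf anf => /=; do 4 move=> /fineK <-.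
by rewrite -!EFinB -!EFinD => -[] ?; congr EFin; lra.
Qed.

(** The signed version: [cross_eq] for the two parts of b, where the
integrability of both products makes all the terms finite. *)
Lemma integral_comp_density (b : Y -> R) :
  measurable_fun setT b ->
  mu.-integrable setT (fun x => (b (sigma x) * w x)%:E) ->
  nu.-integrable setT (fun y => (b y * a y)%:E) ->
  \int[mu]_x (b (sigma x) * w x)%:E = \int[nu]_y (b y * a y)%:E.
Proof.
move=> mb ibw iba.
have [mbp mbn] := (measurable_funrpos mb, measurable_funrneg mb).
have [mbps mbns] := (measurableT_comp mbp msigma, measurableT_comp mbn msigma).
rewrite (integral_mul_funrposneg mb ma iba).
have /= -> := integral_mul_funrposneg (measurableT_comp mb msigma) mw ibw.
congr (_ - _); apply: integral_comp_density_ge0 => //.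
- exact: (integrable_mul_le mbps mw (normr_funrpos_le (b \o sigma)) ibw).
- exact: (integrable_mul_le mbp ma (normr_funrpos_le b) iba).
- exact: (integrable_mul_le mbns mw (normr_funrneg_le (b \o sigma)) ibw).
- exact: (integrable_mul_le mbn ma (normr_funrneg_le b) iba).
Qed.

End change_of_variables.

(** * Complex-valued square integrable functions *)

Section complex_coordinates.
Context (R : realType).
Implicit Types z w : R[i].

Lemma ReD z w : Re (z + w) = Re z + Re w. Proof. by case: z w => [a b] []. Qed.
Lemma ImD z w : Im (z + w) = Im z + Im w. Proof. by case: z w => [a b] []. Qed.
Lemma ReN z : Re (- z) = - Re z. Proof. by case: z. Qed.
Lemma ImN z : Im (- z) = - Im z. Proof. by case: z. Qed.
Lemma ReM z w : Re (z * w) = Re z * Re w - Im z * Im w.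
Proof. by case: z w => [a b] []. Qed.
Lemma ImM z w : Im (z * w) = Re z * Im w + Im z * Re w.
Proof. by case: z w => [a b] []. Qed.
Lemma ReJ z : Re (conjc z) = Re z. Proof. by case: z. Qed.
Lemma ImJ z : Im (conjc z) = - Im z. Proof. by case: z. Qed.

Definition coordE := (ReD, ImD, ReN, ImN, ReM, ImM, ReJ, ImJ).

Definition sqnormc z : R := Re z ^+ 2 + Im z ^+ 2.

Lemma sqnormc_ge0 z : 0 <= sqnormc z.
Proof. by rewrite addr_ge0// sqr_ge0. Qed.

Lemma sqnormcE z : sqnormc z = Normc.normc z ^+ 2.
Proof.
by case: z => a b; rewrite /= sqr_sqrtr// addr_ge0// sqr_ge0.
Qed.

Lemma sqnormcM z w : sqnormc (z * w) = sqnormc z * sqnormc w.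
Proof. rewrite /sqnormc !coordE; ring. Qed.

Lemma sqnormcN z : sqnormc (- z) = sqnormc z.
Proof. by rewrite /sqnormc !coordE !sqrrN. Qed.

(** The difference of the two sides is |z - w|^2. *)
Lemma sqnormcD_le z w : sqnormc (z + w) <= 2 * (sqnormc z + sqnormc w).
Proof.
rewrite /sqnormc !coordE -subr_ge0.
set a := Re z; set b := Im z; set c := Re w; set e := Im w.
rewrite [leRHS](_ : _ = (a - c) ^+ 2 + (b - e) ^+ 2); last by ring.
by rewrite addr_ge0// sqr_ge0.
Qed.

Lemma sqnormc_eq0 z : sqnormc z = 0 -> z = 0.
Proof. by rewrite sqnormcE => /eqP; rewrite sqrf_eq0 => /eqP/Normc.eq0_normc. Qed.

Lemma normr_Re_le z : `|Re z| <= Normc.normc z.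
Proof.
by case: z => a b /=; rewrite -sqrtr_sqr ler_wsqrtr// lerDl sqr_ge0.
Qed.

Lemma normr_Im_le z : `|Im z| <= Normc.normc z.
Proof.
by case: z => a b /=; rewrite -sqrtr_sqr ler_wsqrtr// lerDr sqr_ge0.
Qed.

Lemma normc_ge0 z : 0 <= Normc.normc z.
Proof. by case: z => a b; exact: sqrtr_ge0. Qed.

Lemma normcJ z : Normc.normc (conjc z) = Normc.normc z.
Proof. by case: z => a b /=; rewrite sqrrN. Qed.

Lemma normcM_le z w : Normc.normc z * Normc.normc w <= sqnormc z + sqnormc w.
Proof.
rewrite !sqnormcE; have := normc_ge0 z; have := normc_ge0 w.
set a := Normc.normc z; set b := Normc.normc w; nra.
Qed.

End complex_coordinates.

Section complex_measurability.
Context d (X : measurableType d) (R : realType).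
Implicit Types f g : X -> R[i].

Lemma cmeasurable_cst (c : R[i]) : cmeasurable (fun _ : X => c).
Proof. by split; exact: measurable_cst. Qed.

Lemma cmeasurableD f g : cmeasurable f -> cmeasurable g ->
  cmeasurable (fun x => f x + g x).
Proof.
move=> [f1 f2] [g1 g2]; split.
  by under eq_fun do rewrite ReD; exact: measurable_funD.
by under eq_fun do rewrite ImD; exact: measurable_funD.
Qed.

Lemma cmeasurableN f : cmeasurable f -> cmeasurable (fun x => - f x).
Proof.
move=> [f1 f2]; split.
  by under eq_fun do rewrite ReN; exact: measurableT_comp.
by under eq_fun do rewrite ImN; exact: measurableT_comp.
Qed.

Lemma cmeasurableB f g : cmeasurable f -> cmeasurable g ->
  cmeasurable (fun x => f x - g x).
Proof. by move=> mf mg; apply: cmeasurableD => //; exact: cmeasurableN. Qed.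

Lemma cmeasurableM f g : cmeasurable f -> cmeasurable g ->
  cmeasurable (fun x => f x * g x).
Proof.
move=> [f1 f2] [g1 g2]; split.
  under eq_fun do rewrite ReM.
  by apply: measurable_funB; exact: measurable_funM.
under eq_fun do rewrite ImM.
by apply: measurable_funD; exact: measurable_funM.
Qed.

Lemma cmeasurableJ f : cmeasurable f -> cmeasurable (fun x => conjc (f x)).
Proof.
move=> [f1 f2]; split; first by under eq_fun do rewrite ReJ.
by under eq_fun do rewrite ImJ; exact: measurableT_comp.
Qed.

Lemma cmeasurable_comp (sigma : X -> X) f : measurable_fun setT sigma ->
  cmeasurable f -> cmeasurable (f \o sigma).
Proof.
move=> ms [f1 f2]; split.
  exact: (measurableT_comp f1 ms).
exact: (measurableT_comp f2 ms).
Qed.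

Lemma measurable_sqnormc f : cmeasurable f ->
  measurable_fun setT (fun x => sqnormc (f x)).
Proof. by move=> [f1 f2]; apply: measurable_funD; exact: measurable_funX. Qed.

End complex_measurability.

Section L2_calculus.
Context d (X : measurableType d) (R : realType).
Variable mu : {measure set X -> \bar R}.
Implicit Types f g h : X -> R[i].

(** The square of the L^2 norm, as an extended real: unlike the norm it involves
no roots, and the constants of [energyD_le] are good enough for what follows. *)
Definition energy f : \bar R := (\int[mu]_x (sqnormc (f x))%:E)%E.

Lemma energy_ge0 f : (0 <= energy f)%E.
Proof. by apply: integral_ge0 => x _; rewrite lee_fin sqnormc_ge0. Qed.

Lemma L2norm_sq f : (L2norm mu f `^ 2 = energy f)%E.
Proof.
rewrite /L2norm poweR_Lnorm//; apply: eq_integral => x _ /=.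
rewrite ger0_norm ?normc_ge0// powR_mulrn ?normc_ge0//.
by rewrite sqnormcE.
Qed.

Lemma L2norm_ltE f (e : R) : 0 < e ->
  (L2norm mu f < e%:E)%E = (energy f < (e ^+ 2)%:E)%E.
Proof.
move=> e0; rewrite -L2norm_sq.
have : (0 <= L2norm mu f)%E by exact: Lnorm_ge0.
case: (L2norm mu f) => [r| |//]; last by rewrite poweRyr.
rewrite lee_fin => r0; rewrite poweR_EFin powR_mulrn// !lte_fin.
by rewrite ltr_sqr// nnegrE ltW.
Qed.

Lemma L2norm_ltyE f : (L2norm mu f < +oo)%E = (energy f < +oo)%E.
Proof.
rewrite -L2norm_sq; apply/idP/idP; first exact: poweR_lty.
exact: lty_poweRy.
Qed.

Lemma L2P f : L2 mu f <-> cmeasurable f /\ (energy f < +oo)%E.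
Proof. by rewrite /L2/= L2norm_ltyE. Qed.

Lemma ae_eq_energy f g : cmeasurable f -> cmeasurable g ->
  f = g %[ae mu] -> energy f = energy g.
Proof.
move=> mf mg fg; apply: ge0_ae_eq_integral => //.
- exact/measurable_EFinP/measurable_sqnormc.
- exact/measurable_EFinP/measurable_sqnormc.
- by move=> x _; rewrite lee_fin sqnormc_ge0.
- by move=> x _; rewrite lee_fin sqnormc_ge0.
- by apply: filterS fg => x /[apply] ->.
Qed.

Lemma energy_eq0 f : cmeasurable f -> energy f = 0%E -> f = cst 0 %[ae mu].
Proof.
move=> mf f0.
have mE : measurable_fun setT (fun x => (sqnormc (f x))%:E).
  exact/measurable_EFinP/measurable_sqnormc.
have : (\int[mu]_x `|(sqnormc (f x))%:E| = 0)%E.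
  rewrite -f0; apply: eq_integral => x _.
  by rewrite gee0_abs// lee_fin sqnormc_ge0.
move=> /(ae_eq_integral_abs mu measurableT mE); apply: filterS => x /[apply].
by move=> [/sqnormc_eq0].
Qed.

Lemma energyD_le f g : cmeasurable f -> cmeasurable g ->
  (energy (fun x => f x + g x)%R <= 2%:E * (energy f + energy g))%E.
Proof.
move=> mf mg; have [mf2 mg2] := (measurable_sqnormc mf, measurable_sqnormc mg).
rewrite /energy -ge0_integralD//; last 4 first.
- by move=> x _; rewrite lee_fin sqnormc_ge0.
- exact/measurable_EFinP.
- by move=> x _; rewrite lee_fin sqnormc_ge0.
- exact/measurable_EFinP.
rewrite -ge0_integralZl//; last 2 first.
- by apply: emeasurable_funD; exact/measurable_EFinP.
- by move=> x _; rewrite -EFinD lee_fin addr_ge0// sqnormc_ge0.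
apply: ge0_le_integral => //.
- by move=> x _; rewrite lee_fin sqnormc_ge0.
- exact/measurable_EFinP/measurable_sqnormc/cmeasurableD.
- apply: emeasurable_funM => //.
  by apply: emeasurable_funD; exact/measurable_EFinP.
- by move=> x _; rewrite -EFinD -EFinM lee_fin sqnormcD_le.
Qed.

Lemma energyZ (c : R[i]) f : cmeasurable f ->
  energy (fun x => c * f x) = ((sqnormc c)%:E * energy f)%E.
Proof.
move=> mf; rewrite /energy -ge0_integralZl//.
- by apply: eq_integral => x _; rewrite sqnormcM EFinM.
- exact/measurable_EFinP/measurable_sqnormc.
- by move=> x _; rewrite lee_fin sqnormc_ge0.
- by rewrite lee_fin sqnormc_ge0.
Qed.

Lemma energyN f : energy (fun x => - f x) = energy f.
Proof. by apply: eq_integral => x _; rewrite sqnormcN. Qed.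

Lemma L20 : L2 mu (fun=> 0).
Proof.
apply/L2P; split; first exact: cmeasurable_cst.
by rewrite /energy; under eq_integral do
  rewrite /sqnormc /= expr0n/= addr0; rewrite integral0.
Qed.

Lemma L2D f g : L2 mu f -> L2 mu g -> L2 mu (fun x => f x + g x).
Proof.
move=> /L2P[mf f2] /L2P[mg g2]; apply/L2P; split; first exact: cmeasurableD.
apply: le_lt_trans (energyD_le mf mg) _.
by rewrite lte_mul_pinfty// lte_add_pinfty.
Qed.

Lemma L2Z (c : R[i]) f : L2 mu f -> L2 mu (fun x => c * f x).
Proof.
move=> /L2P[mf f2]; apply/L2P; split.
  by apply: cmeasurableM => //; exact: cmeasurable_cst.
by rewrite energyZ// lte_mul_pinfty// lee_fin sqnormc_ge0.
Qed.

Lemma integrable_sqnormc f : L2 mu f ->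
  mu.-integrable setT (fun x => (sqnormc (f x))%:E).
Proof.
move=> /L2P[mf f2]; apply/integrableP; split.
  exact/measurable_EFinP/measurable_sqnormc.
under eq_integral do rewrite gee0_abs ?lee_fin ?sqnormc_ge0//.
exact: f2.
Qed.

Lemma integrable_le_sqnormcD (u : X -> R) f g : measurable_fun setT u ->
  L2 mu f -> L2 mu g -> (forall x, `|u x| <= sqnormc (f x) + sqnormc (g x)) ->
  mu.-integrable setT (EFin \o u).
Proof.
move=> mu_u Lf Lg ule.
have := integrableD measurableT (integrable_sqnormc Lf) (integrable_sqnormc Lg).
apply: le_integrable => //; first exact/measurable_EFinP.
move=> x _ /=; rewrite lee_fin (le_trans (ule x))//.
by rewrite ger0_norm// addr_ge0// sqnormc_ge0.
Qed.

Lemma integrable_Re_dot f g : L2 mu f -> L2 mu g ->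
  mu.-integrable setT (EFin \o (fun x => Re (f x * conjc (g x)))).
Proof.
move=> Lf Lg; apply: (integrable_le_sqnormcD _ Lf Lg).
  have [[mf _] [mg _]] := (Lf, Lg).
  by have [] := cmeasurableM mf (cmeasurableJ mg).
move=> x; apply: le_trans (normcM_le _ _).
by rewrite -(normcJ (g x)) -Normc.normcM normr_Re_le.
Qed.

Lemma Re_L2dotD f g h : L2 mu f -> L2 mu g -> L2 mu h ->
  Re (L2dot mu f (fun x => g x + h x)) = Re (L2dot mu f g) + Re (L2dot mu f h).
Proof.
move=> Lf Lg Lh /=.
rewrite -RintegralD//; [|exact: integrable_Re_dot..].
by apply: eq_Rintegral => x _; rewrite !coordE; ring.
Qed.

(** Integrate |f|^2 + 2 Re (f (conj g)) <= |f + g|^2. *)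
Lemma energy_le_orthogonal f g : L2 mu f -> L2 mu g ->
  Re (L2dot mu f g) = 0 -> (energy f <= energy (fun x => f x + g x)%R)%E.
Proof.
move=> Lf Lg fg0.
have ifg := integrable_Re_dot Lf Lg.
have fgE : (\int[mu]_x (Re (f x * conjc (g x))%R)%:E = 0)%E.
  have := integrable_fin_num measurableT ifg.
  by move=> /fineK <-; congr EFin.
rewrite -[leLHS]adde0 -[X in (_ + X)%E](mule0 2%:E) -fgE /energy.
rewrite -integralZl// -integralD//; last 2 first.
- exact: integrable_sqnormc.
- exact: integrableZl.
apply: le_integral => //.
- by apply: integrableD => //; [exact: integrable_sqnormc|exact: integrableZl].
- exact/integrable_sqnormc/L2D.
move=> x _; rewrite /sqnormc -EFinM -EFinD lee_fin !coordE.
have := sqr_ge0 (Re (g x)); have := sqr_ge0 (Im (g x)); nra.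
Qed.

End L2_calculus.

(** * Orthogonal expansions in L^2 *)

Section orthogonal_expansions.
Context d (X : measurableType d) (R : realType).
Variable mu : {measure set X -> \bar R}.

Lemma L2_has_sum_energy (I : choiceType) (u : I -> X -> R[i]) f (e : R) :
  L2_has_sum mu u f -> 0 < e -> exists F0 : {fset I}, forall F : {fset I},
    (F0 `<=` F)%fset -> (energy mu (fun x => f x - \sum_(i <- F) u i x)%R < e%:E)%E.
Proof.
move=> uf e0.
have : nbhs (0%E : \bar R) [set y | (y < (Num.sqrt e)%:E)%E].
  by apply: open_ereal_lt'; rewrite lte_fin sqrtr_gt0.
move=> /uf [F0 _ F0P]; exists F0 => F /F0P /=.
by rewrite L2norm_ltE ?sqrtr_gt0// sqr_sqrtr// ltW.
Qed.

Variables (I : choiceType) (V : I -> set (X -> R[i])).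
Hypotheses (V_L2 : forall i, V i `<=` L2 mu) (V0 : forall i, V i (fun=> 0)).
Hypothesis VD : forall i f g, V i f -> V i g -> V i (fun x => f x + g x).
Hypothesis VZ : forall i (c : R[i]) f, V i f -> V i (fun x => c * f x).
Hypothesis V_ae : forall i f g,
  V i f -> cmeasurable g -> f = g %[ae mu] -> V i g.
Hypothesis V_orth : forall i j, i != j ->
  forall f g, V i f -> V j g -> L2dot mu f g = 0.
Hypothesis V_sum : forall f, L2 mu f ->
  exists2 h : I -> X -> R[i], (forall i, V i (h i)) & L2_has_sum mu h f.

Let VB i f g : V i f -> V i g -> V i (fun x => f x - g x).
Proof.
move=> Vf Vg; under eq_fun do rewrite -mulN1r.
by apply: VD => //; exact: VZ.
Qed.

Let L2_sum (k : I -> X -> R[i]) (r : seq I) : (forall i, V i (k i)) ->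
  L2 mu (fun x => \sum_(i <- r) k i x).
Proof.
move=> Vk; elim: r => [|i r IH].
  by under eq_fun do rewrite big_nil; exact: L20.
under eq_fun do rewrite big_cons.
by apply: L2D => //; exact: V_L2 (Vk i).
Qed.

Let orth_sum (k : I -> X -> R[i]) i (f : X -> R[i]) (r : seq I) :
  (forall j, V j (k j)) -> V i f -> i \notin r ->
  Re (L2dot mu f (fun x => \sum_(j <- r) k j x)) = 0.
Proof.
move=> Vk Vf; elim: r => [_|j r IH].
  rewrite /= /Rintegral integral0_eq// => x _.
  by rewrite big_nil !coordE/= oppr0 !mulr0 subr0.
rewrite inE negb_or => /andP[ij ir].
under [fun x => _]eq_fun do rewrite big_cons.
rewrite Re_L2dotD; [|exact: V_L2 Vf|exact: V_L2 (Vk j)|exact: L2_sum].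
by rewrite IH// (V_orth ij Vf (Vk j)) addr0.
Qed.

(** Split off k_i: the other terms of the sum are orthogonal to it. *)
Lemma energy_component_le (k : I -> X -> R[i]) (F : {fset I}) i :
  (forall j, V j (k j)) -> i \in F ->
  (energy mu (k i) <= energy mu (fun x => \sum_(j <- F) k j x)%R)%E.
Proof.
move=> Vk iF; under [X in (_ <= energy mu X)%E]eq_fun do rewrite (big_fsetD1 i)//=.
apply: energy_le_orthogonal; [exact: V_L2 (Vk i)|exact: L2_sum|].
by apply: (orth_sum Vk (Vk i)); rewrite !inE eqxx.
Qed.

(** The differences k_j - k'_j are again components, and their sum is the
difference of two functions close to f. *)
Lemma energy_componentB_le (k k' : I -> X -> R[i]) f (F : {fset I}) i (e : R) :
  L2 mu f -> (forall j, V j (k j)) -> (forall j, V j (k' j)) -> i \in F ->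
  (energy mu (fun x => f x - \sum_(j <- F) k j x)%R < e%:E)%E ->
  (energy mu (fun x => f x - \sum_(j <- F) k' j x)%R < e%:E)%E ->
  (energy mu (fun x => k i x - k' i x)%R <= (4 * e)%:E)%E.
Proof.
move=> [mf _] Vk Vk' iF ke k'e.
have mk (u : I -> X -> R[i]) : (forall j, V j (u j)) ->
    cmeasurable (fun x => f x - \sum_(j <- F) u j x).
  by move=> Vu; apply: cmeasurableB => //; exact: (L2_sum F Vu).1.
apply: (le_trans (energy_component_le (k := fun j x => k j x - k' j x) _ iF)).
  by move=> j; exact: VB.
rewrite [X in energy mu X](_ : _ = fun x =>
    (f x - \sum_(j <- F) k' j x) + - (f x - \sum_(j <- F) k j x)); last first.
  by apply/funext => x; rewrite sumrB; ring.
apply: le_trans (energyD_le _ (mk _ Vk') (cmeasurableN (mk _ Vk))) _.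
rewrite energyN (_ : (4 * e)%:E = 2%:E * (e%:E + e%:E))%E; last first.
  by rewrite -EFinD -EFinM; congr EFin; ring.
by rewrite lee_pmul2l// leeD// ltW.
Qed.

(* The factor 10 is the largest constant met below: 4 comes from
   [energy_componentB_le] and 10 = 2 (1 + 4) from one more use of
   [energyD_le]. *)
Let energy_small f : cmeasurable f ->
  (forall e : R, 0 < e -> (energy mu f <= (10 * e)%:E)%E) -> f = cst 0 %[ae mu].
Proof.
move=> mf fe; apply: energy_eq0 => //; apply/eqP; rewrite eq_le energy_ge0 andbT.
apply/lee_addgt0Pr => e e0; rewrite add0e.
by have := fe (e / 10); rewrite divr_gt0// mulrC divfK//; exact.
Qed.

Let V_closed i f : L2 mu f ->
  (forall e : R, 0 < e ->
    exists2 g, V i g & (L2norm mu (fun x => (f x - g x)%R) < e%:E)%E) -> V i f.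
Proof.
move=> Lf f_near; have [h Vh hf] := V_sum Lf.
apply: (V_ae (Vh i) Lf.1).
suff : (fun x => f x - h i x) = cst 0 %[ae mu].
  by apply: filterS => x /[apply] /eqP; rewrite subr_eq0 => /eqP.
have mh := (V_L2 (Vh i)).1.
apply: energy_small => [|e e0]; first exact: cmeasurableB Lf.1 mh.
have [F0 F0P] := L2_has_sum_energy hf e0.
have e20 : 0 < Num.sqrt e by rewrite sqrtr_gt0.
have [g Vg] := f_near _ e20; rewrite L2norm_ltE// sqr_sqrtr ?(ltW e0)// => fg.
have mg := (V_L2 Vg).1.
(* g as a finite sum of components, over a set large enough for h *)
pose k j : X -> R[i] := if j == i then g else fun=> 0.
have Vk j : V j (k j) by rewrite /k; case: eqP => [->|_].
have iF : i \in (i |` F0)%fset by rewrite !inE eqxx.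
have kg x : \sum_(j <- (i |` F0)%fset) k j x = g x.
  rewrite (big_fsetD1 i)//= /k eqxx big_seq big1 ?addr0// => j.
  by rewrite !inE => /andP[/negbTE ->].
have kF : (energy mu (fun x => f x - \sum_(j <- (i |` F0)%fset) k j x)%R < e%:E)%E.
  by under [X in energy mu X]eq_fun do rewrite kg.
have := energy_componentB_le Lf Vk Vh iF kF (F0P _ (fsubsetUr _ _)).
rewrite /k eqxx => gh.
rewrite [X in energy mu X](_ : _ = fun x => (f x - g x) + (g x - h i x)); last first.
  by apply/funext => x; ring.
apply: le_trans (energyD_le _ (cmeasurableB Lf.1 mg) (cmeasurableB mg mh)) _.
rewrite (_ : (10 * e)%:E = 2%:E * (e%:E + (4 * e)%:E))%E; last first.
  by rewrite -EFinD -EFinM; congr EFin; ring.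
by rewrite lee_pmul2l// leeD// ltW.
Qed.

(** Closedness and uniqueness both say that some f - h_i or h'_i - h_i vanishes,
which [energy_componentB_le] shows by making its energy arbitrarily small. *)
Theorem L2_orthogonal_direct_sum_of_expansion : L2_orthogonal_direct_sum mu V.
Proof.
split=> [i|//|f Lf].
  by split; [exact: V_L2|exact: V0|exact: VD|exact: VZ|exact: V_closed].
have [h Vh hf] := V_sum Lf; exists h; split=> // h' Vh' h'f i.
suff : (fun x => h' i x - h i x) = cst 0 %[ae mu].
  by apply: filterS => x /[apply] /eqP; rewrite subr_eq0 => /eqP.
apply: energy_small => [|e e0].
  by apply: cmeasurableB; [exact: (V_L2 (Vh' i)).1|exact: (V_L2 (Vh i)).1].
have [F hF] := L2_has_sum_energy hf e0.
have [F' h'F'] := L2_has_sum_energy h'f e0.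
pose G := (i |` (F `|` F'))%fset.
have iG : i \in G by rewrite !inE eqxx.
apply: le_trans (energy_componentB_le Lf Vh' Vh iG (h'F' G _) (hF G _)) _.
- exact: fsubset_trans (fsubsetUr _ _) (fsubsetUr _ _).
- exact: fsubset_trans (fsubsetUl _ _) (fsubsetUr _ _).
by rewrite lee_fin; lra.
Qed.

End orthogonal_expansions.

(** * Densities pushed by an endomorphism *)

Section pushed_densities.
Context d (X : measurableType d) (R : realType).
Variables (mu : probability X R) (sigma : {mfun X >-> X}).

Definition is_pushed_density (u a : X -> R) :=
  [/\ mu.-integrable setT (EFin \o u), mu.-integrable setT (EFin \o a) &
      forall B, measurable B ->
        (\int[mu]_(x in sigma @^-1` B) (u x)%:E = \int[mu]_(x in B) (a x)%:E)%E].

Lemma is_pushed_density_ae (u a a' : X -> R) :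
  is_pushed_density u a -> measurable_fun setT a' -> a = a' %[ae mu] ->
  is_pushed_density u a'.
Proof.
move=> [iu ia ua] ma' aa'.
have ma : measurable_fun setT a.
  by apply/measurable_EFinP; exact: measurable_int ia.
have aaE : ae_eq mu setT (EFin \o a) (EFin \o a').
  by apply: filterS aa' => x /[apply] /= ->.
split=> //.
- apply/integrableP; split; first exact/measurable_EFinP.
  have /integrableP[_] := ia; congr (_ < _)%E; apply: ae_eq_integral => //.
  + by apply: measurableT_comp => //; exact/measurable_EFinP.
  + by apply: measurableT_comp => //; exact/measurable_EFinP.
  + by apply: filterS aaE => x /[apply] ->.
- move=> B mB; rewrite ua//; apply: ae_eq_integral => //.
  + by apply: measurable_funTS; exact/measurable_EFinP.
  + by apply: measurable_funTS; exact/measurable_EFinP.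
  + by apply: filterS aaE => x /(_ I) + _.
Qed.

Hypothesis qi : quasi_invariant mu sigma.

(** Quasi-invariance makes the pushed charge absolutely continuous, so that the
Radon-Nikodym theorem applies. *)
Lemma RN_pushedP (u : X -> R) : mu.-integrable setT (EFin \o u) ->
  is_pushed_density u (RN_pushed mu sigma u).
Proof.
move=> iu; rewrite /RN_pushed; case: pselect => // iu'.
have dom : pushed_charge sigma iu' `<< mu.
  apply/null_content_dominatesP => A mA muA.
  have mSA : measurable (sigma @^-1` A).
    by rewrite -[X in measurable X]setTI; exact: (measurable_funP sigma).
  rewrite /= /pushforward /induced_charge null_set_integral//.
  - by apply: measurable_funTS; exact: measurable_int iu.
  - exact/(qi mA).
have finE : EFin \o (fine \o Radon_Nikodym (pushed_charge sigma iu') mu) =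
    Radon_Nikodym (pushed_charge sigma iu') mu.
  by apply/funext => x /=; rewrite fineK// Radon_Nikodym_fin_num.
split=> //; first by rewrite finE; exact: Radon_Nikodym_integrable.
move=> B mB; transitivity (pushed_charge sigma iu' B); first by [].
rewrite (Radon_Nikodym_integral dom mB).
by apply: eq_integral => x _; rewrite -[in LHS]finE.
Qed.

(** Here q mu is pushed to mu, and the pointwise bound is what 2 x y <= x^2 + y^2
gives for |u| <= sqrt (q p).  If a were known to be square integrable, the
choice t = a o sigma would give
  2 int a^2 = 2 int (a o sigma) u <= int (a o sigma)^2 q + int p
            = int a^2 + int p,
hence the conclusion.  So run this with the truncation b of a to the set
A n where |a| <= n, for which b a = b^2, and let n tend to infinity. *)
Lemma pushed_density_energy_le (u a q p : X -> R) :
  is_pushed_density u a -> is_pushed_density q (cst 1) ->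
  (forall x, 0 <= q x) -> mu.-integrable setT (EFin \o p) ->
  (forall x (t : R), 2 * (t * u x) <= t ^+ 2 * q x + p x) ->
  (\int[mu]_x (a x ^+ 2)%:E <= \int[mu]_x (p x)%:E)%E.
Proof.
move=> [iu ia ua] [iq _ q1] q0 ip upq.
have ma : measurable_fun setT a.
  by apply/measurable_EFinP; exact: measurable_int ia.
have mq : measurable_fun setT q.
  by apply/measurable_EFinP; exact: measurable_int iq.
have mu_u : measurable_fun setT u.
  by apply/measurable_EFinP; exact: measurable_int iu.
have ma2 : measurable_fun setT (fun x => (a x ^+ 2)%:E).
  exact/measurable_EFinP/measurable_funX.
pose A n := [set x | `|a x| <= n%:R].
have mA n : measurable (A n).
  rewrite [X in measurable X](_ : _ =
      setT `&` (fun x => `|a x|) @^-1` `]-oo, n%:R]).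
    by apply: measurableT_comp.
  by rewrite setTI; apply/seteqP; split => x /=; rewrite in_itv.
have ubound n : (\int[mu]_(x in A n) (a x ^+ 2)%:E <= \int[mu]_x (p x)%:E)%E.
  pose b x := a x * \1_(A n) x.
  have mb : measurable_fun setT b by exact: measurable_funM.
  have b_le x : `|b x| <= n%:R.
    rewrite /b indicE; case: (boolP (x \in A n)) => [|_].
      by rewrite inE mulr1.
    by rewrite mulr0 normr0.
  have bounded (v w : X -> R) : measurable_fun setT v ->
      (forall x, `|v x| <= n%:R) -> mu.-integrable setT (EFin \o w) ->
      mu.-integrable setT (fun x => (v x * w x)%:E).
    move=> mv vn iw.
    have := integrableZl measurableT n%:R iw; apply: le_integrable => //.
      apply/measurable_EFinP/measurable_funM => //.
      by apply/measurable_EFinP; exact: measurable_int iw.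
    by move=> x _ /=; rewrite lee_fin !normrM ler_wpM2r// normr_nat.
  have iba := bounded _ _ mb b_le ia.
  have ibu := bounded (b \o sigma) u (measurableT_comp mb (measurable_funP sigma))
    (fun x => b_le (sigma x)) iu.
  have baE x : b x * a x = b x ^+ 2.
    rewrite /b indicE; case: (x \in A n);
      by rewrite /= ?mulr1 ?mulr0 ?mul0r ?expr0n ?expr2.
  have trunE : (\int[mu]_(x in A n) (a x ^+ 2)%:E = \int[mu]_x (b x * a x)%:E)%E.
    rewrite integral_mkcond; apply: eq_integral => x _.
    rewrite baE /patch /b indicE.
    by case: (x \in A n); rewrite /= ?mulr1 ?mulr0 ?expr0n.
  have key := integral_comp_density (measurable_funP sigma) iu ia ua mb ibu iba.
  have sqE : (\int[mu]_x ((b (sigma x) ^+ 2) * q x)%:E =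
      \int[mu]_x (b x * a x)%:E)%E.
    under [RHS]eq_integral do rewrite baE -[X in (X)%:E]mulr1.
    apply: (ge0_integral_comp_density (b := fun x => (b x ^+ 2)%:E)
      (a := cst 1) (measurable_funP sigma)) => //.
    - exact/measurable_EFinP/measurable_funX.
    - by move=> y; rewrite lee_fin sqr_ge0.
  have fin := integrable_fin_num measurableT iba.
  have ibq : mu.-integrable setT (fun x => (b (sigma x) ^+ 2 * q x)%:E).
    apply/integrableP; split.
      apply/measurable_EFinP/measurable_funM => //; apply: measurable_funX.
      exact: (measurableT_comp mb (measurable_funP sigma)).
    rewrite [ltLHS](_ : _ = \int[mu]_x (b x * a x)%:E)%E ?ltey_eq ?fin//.
    rewrite -sqE; apply: eq_integral => x _.
    by rewrite gee0_abs// lee_fin mulr_ge0 ?sqr_ge0.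
  have : (\int[mu]_x (2%:E * (b (sigma x) * u x)%:E) <=
      \int[mu]_x ((b (sigma x) ^+ 2 * q x)%:E + (p x)%:E))%E.
    apply: le_integral => //; first exact: integrableZl.
    - exact: integrableD.
    - by move=> x _; rewrite -EFinM -EFinD lee_fin.
  rewrite integralZl// integralD// sqE key trunE.
  have := integrable_fin_num measurableT ip.
  move: fin => /= /fineK <- /fineK <-.
  rewrite -EFinM -EFinD !lee_fin; lra.
have AT : \bigcup_n A n = setT.
  apply/seteqP; split=> // x _; exists (Num.truncn `|a x|).+1 => //=.
  exact/ltW/truncnS_gt.
have mono : {homo A : n k / (n <= k)%N >-> (n <= k)%O}.
  move=> n k nk; apply/subsetPset => x /= /le_trans; apply.
  by rewrite ler_nat.
have := ge0_nondecreasing_set_cvg_integral (mu := mu) mono mA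
  (fun n => measurable_funTS ma2).
rewrite AT => cvA; apply: (cvge_to_le (cvA _)); last exact: nearW.
by move=> n x _; rewrite lee_fin sqr_ge0.
Qed.

End pushed_densities.

(** * Weighted composition operators and the direct sum *)

Section weighted_composition.
Context d (X : measurableType d) (R : realType).
Variables (mu : probability X R) (sigma : {mfun X >-> X}) (phi : X -> R).
Hypotheses (qi : quasi_invariant mu sigma) (mphi : measurable_fun setT phi).
Implicit Types f g M N : X -> R[i].

Local Notation s := (sqrt_phi phi).

Let ms : cmeasurable s.
Proof.
split; last exact: measurable_cst.
have msqrt := continuous_measurable_fun (@sqrt_continuous R).
exact: (measurableT_comp msqrt mphi).
Qed.

Lemma cmeasurable_S_phi f : cmeasurable f -> cmeasurable (S_phi sigma phi f).
Proof.
move=> mf; apply: cmeasurableM => //.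
by apply: cmeasurable_comp => //; exact: measurable_funP.
Qed.

(** The operator T_i of the introduction, for m_i = M. *)
Definition wcomp M f : X -> R[i] := fun x => M x * S_phi sigma phi f x.

Lemma cmeasurable_wcomp M f : cmeasurable M -> cmeasurable f ->
  cmeasurable (wcomp M f).
Proof. by move=> mM mf; apply: cmeasurableM => //; exact: cmeasurable_S_phi. Qed.

Lemma mulHP M k : mulH mu sigma phi M k <->
  cmeasurable k /\ exists2 f, L2 mu f & k = wcomp M f %[ae mu].
Proof.
split=> -[mk].
- move=> [h [mh [f Lf hf]] kh]; split=> //; exists f => //.
  by apply: filterS2 hf kh => x /(_ I) hf /(_ I) kh _; rewrite kh hf.
- move=> [f Lf kf]; split=> //; exists (S_phi sigma phi f) => //.
  split; first exact: cmeasurable_S_phi Lf.1.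
  by exists f => //; exact: aeW.
Qed.

(** This is M (conj N) s^2, with its factors in the order in which the integrand of
[S_phi_adj] produces them. *)
Definition cross_weight M N : X -> R[i] :=
  fun x => s x * conjc (N x) * M x * s x.

Lemma is_pushed_density_cross_weight M N (c : R[i]) :
  S_phi_adj_dom mu phi (fun x => s x * conjc (N x) * M x) ->
  S_phi_adj mu sigma phi (fun x => s x * conjc (N x) * M x) = (fun=> c) %[ae mu] ->
  is_pushed_density mu sigma (fun x => Re (cross_weight M N x)) (cst (Re c)) /\
  is_pushed_density mu sigma (fun x => Im (cross_weight M N x)) (cst (Im c)).
Proof.
move=> [iRe iIm] adjE; split.
- apply: is_pushed_density_ae (RN_pushedP qi iRe) _ _ => //.
  by apply: filterS adjE => x /[apply] <-.
- apply: is_pushed_density_ae (RN_pushedP qi iIm) _ _ => //.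
  by apply: filterS adjE => x /[apply] <-.
Qed.

Lemma Re_cross_weight_diag M x : Re (cross_weight M M x) = sqnormc (M x * s x).
Proof. by rewrite /cross_weight /sqnormc /sqrt_phi !coordE/=; ring. Qed.

(** The case i = j of the hypothesis on the pairs, in terms of |M s|^2. *)
Definition unit_weight M := cmeasurable M /\
  is_pushed_density mu sigma (fun x => sqnormc (M x * s x)) (cst 1).

(** Change of variables with |T f|^2 = (|f|^2 o sigma) |M s|^2. *)
Lemma energy_wcomp M f : unit_weight M -> cmeasurable f ->
  energy mu (wcomp M f) = energy mu f.
Proof.
move=> [mM [_ _ M1]] mf.
transitivity (\int[mu]_x
    ((sqnormc (f (sigma x)))%:E * (sqnormc (M x * s x))%:E))%E.
  apply: eq_integral => x _; rewrite -EFinM -sqnormcM; congr (sqnormc _)%:E.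
  by rewrite /wcomp /S_phi; ring.
rewrite (ge0_integral_comp_density (b := fun y => (sqnormc (f y))%:E) (a := cst 1)
  (measurable_funP sigma) (nu := mu))//.
- by apply: eq_integral => x _; rewrite mule1.
- by apply: measurable_sqnormc; exact: cmeasurableM.
- by move=> x; exact: sqnormc_ge0.
- exact/measurable_EFinP/measurable_sqnormc.
- by move=> y; rewrite lee_fin sqnormc_ge0.
Qed.

Lemma L2_wcomp M f : unit_weight M -> L2 mu f -> L2 mu (wcomp M f).
Proof.
move=> uM /L2P[mf f2]; apply/L2P; split.
  by apply: cmeasurable_wcomp => //; exact: uM.1.
by rewrite energy_wcomp.
Qed.

Lemma mulH_L2 M : unit_weight M -> mulH mu sigma phi M `<=` L2 mu.
Proof.
move=> uM k /mulHP[mk [f Lf kf]]; apply/L2P; split=> //.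
have /L2P[mMf Mf2] := L2_wcomp uM Lf.
by rewrite (ae_eq_energy mk mMf kf).
Qed.

Lemma mulH_ae M f g : mulH mu sigma phi M f -> cmeasurable g ->
  f = g %[ae mu] -> mulH mu sigma phi M g.
Proof.
move=> /mulHP[_ [h Lh fh]] mg fg; apply/mulHP; split=> //; exists h => //.
by apply: filterS2 fh fg => x /(_ I) <- /(_ I).
Qed.

Lemma mulH0 M : mulH mu sigma phi M (fun=> 0).
Proof.
apply/mulHP; split; first exact: cmeasurable_cst.
exists (fun=> 0); first exact: L20.
by apply: aeW => x _; rewrite /wcomp /S_phi !mulr0.
Qed.

Lemma mulHD M f g : mulH mu sigma phi M f -> mulH mu sigma phi M g ->
  mulH mu sigma phi M (fun x => f x + g x).
Proof.
move=> /mulHP[mf [f' Lf' ff']] /mulHP[mg [g' Lg' gg']]; apply/mulHP; split.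
  exact: cmeasurableD.
exists (fun x => f' x + g' x); first exact: L2D.
apply: filterS2 ff' gg' => x /(_ I) + /(_ I) + _ => -> ->.
by rewrite /wcomp /S_phi; ring.
Qed.

Lemma mulHZ M (c : R[i]) f : mulH mu sigma phi M f ->
  mulH mu sigma phi M (fun x => c * f x).
Proof.
move=> /mulHP[mf [f' Lf' ff']]; apply/mulHP; split.
  by apply: cmeasurableM => //; exact: cmeasurable_cst.
exists (fun x => c * f' x); first exact: L2Z.
apply: filterS ff' => x /(_ I) + _ => ->.
by rewrite /wcomp /S_phi; ring.
Qed.

(** The integrand is (f (conj g) o sigma) times the cross weight; each of the four
products of real coordinates integrates to 0.  They are integrable since the
modulus of the whole is at most |T_M f|^2 + |T_N g|^2. *)
Lemma L2dot_wcomp_eq0 M N f g : unit_weight M -> unit_weight N ->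
  is_pushed_density mu sigma (fun x => Re (cross_weight M N x)) (cst 0) ->
  is_pushed_density mu sigma (fun x => Im (cross_weight M N x)) (cst 0) ->
  L2 mu f -> L2 mu g -> L2dot mu (wcomp M f) (wcomp N g) = 0.
Proof.
move=> uM uN pRe pIm Lf Lg.
have [LMf LNg] := (L2_wcomp uM Lf, L2_wcomp uN Lg).
pose b x := f x * conjc (g x).
have mb : cmeasurable b.
  by apply: cmeasurableM; [exact: Lf.1|exact/cmeasurableJ/Lg.1].
have prodE x :
    wcomp M f x * conjc (wcomp N g x) = b (sigma x) * cross_weight M N x.
  apply/eqP; rewrite eq_complex /wcomp /S_phi /b /cross_weight /sqrt_phi !coordE/=.
  by apply/andP; split; apply/eqP; ring.
have term (b' w : X -> R) : measurable_fun setT b' ->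
    (forall x, `|b' x| <= Normc.normc (b x)) ->
    is_pushed_density mu sigma w (cst 0) ->
    (forall x, `|w x| <= Normc.normc (cross_weight M N x)) ->
    mu.-integrable setT (EFin \o (fun x => b' (sigma x) * w x)) /\
    \int[mu]_x (b' (sigma x) * w x) = 0.
  move=> mb' b'b [iw i0 w0] w_le.
  have mw : measurable_fun setT w.
    by apply/measurable_EFinP; exact: measurable_int iw.
  have ibw : mu.-integrable setT (EFin \o (fun x => b' (sigma x) * w x)).
    apply: (integrable_le_sqnormcD _ LMf LNg).
      apply: measurable_funM => //.
      exact: (measurableT_comp mb' (measurable_funP sigma)).
    move=> x; apply: le_trans (normcM_le _ _).
    rewrite -(normcJ (wcomp N g x)) -Normc.normcM prodE Normc.normcM normrM.
    exact: ler_pM.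
  split=> //; rewrite /Rintegral.
  rewrite (integral_comp_density (b := b') (measurable_funP sigma) iw i0 w0)//.
    by under eq_integral do rewrite mulr0; rewrite integral0.
  by under eq_fun do rewrite mulr0; exact: integrable0.
have bRe x := normr_Re_le (b x); have bIm x := normr_Im_le (b x).
have wRe x := normr_Re_le (cross_weight M N x).
have wIm x := normr_Im_le (cross_weight M N x).
have [i1 e1] := term _ _ mb.1 bRe pRe wRe.
have [i2 e2] := term _ _ mb.2 bIm pIm wIm.
have [i3 e3] := term _ _ mb.1 bRe pIm wIm.
have [i4 e4] := term _ _ mb.2 bIm pRe wRe.
rewrite /L2dot /cintegral.
under eq_Rintegral do rewrite prodE ReM.
under [X in _ +i* X]eq_Rintegral do rewrite prodE ImM.
by rewrite RintegralB// RintegralD// e1 e2 e3 e4 subr0 addr0.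
Qed.

Lemma mulH_orthogonal M N f g : unit_weight M -> unit_weight N ->
  is_pushed_density mu sigma (fun x => Re (cross_weight M N x)) (cst 0) ->
  is_pushed_density mu sigma (fun x => Im (cross_weight M N x)) (cst 0) ->
  mulH mu sigma phi M f -> mulH mu sigma phi N g -> L2dot mu f g = 0.
Proof.
move=> uM uN pRe pIm /mulHP[mf [f' Lf' ff']] /mulHP[mg [g' Lg' gg']].
rewrite -(L2dot_wcomp_eq0 uM uN pRe pIm Lf' Lg').
have mp := cmeasurableM mf (cmeasurableJ mg).
have mp' := cmeasurableM (cmeasurable_wcomp uM.1 Lf'.1)
  (cmeasurableJ (cmeasurable_wcomp uN.1 Lg'.1)).
have pE : {ae mu, forall x, f x * conjc (g x) =
    wcomp M f' x * conjc (wcomp N g' x)}.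
  by apply: filterS2 ff' gg' => x /(_ I) -> /(_ I) ->.
rewrite /L2dot /cintegral /Rintegral.
by congr (fine _ +i* fine _); apply: ae_eq_integral => //;
  try (apply/measurable_EFinP;
       first [exact: mp.1|exact: mp.2|exact: mp'.1|exact: mp'.2]);
  apply: filterS pE => x -> _.
Qed.

(** [pushed_density_energy_le] for the real and imaginary parts of f (conj (M s)),
with q = |M s|^2 and p = |f|^2. *)
Lemma L2_S_phi_adj M f : unit_weight M -> L2 mu f ->
  S_phi_adj_dom mu phi (fun x => conjc (M x) * f x) ->
  L2 mu (S_phi_adj mu sigma phi (fun x => conjc (M x) * f x)).
Proof.
move=> [mM M1] Lf [iRe iIm].
have [pRe pIm] := (RN_pushedP qi iRe, RN_pushedP qi iIm).
have [_ aRe _] := pRe; have [_ aIm _] := pIm.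
have if2 := integrable_sqnormc Lf.
have eRe := pushed_density_energy_le pRe M1 (fun x => sqnormc_ge0 _) if2.
have eIm := pushed_density_energy_le pIm M1 (fun x => sqnormc_ge0 _) if2.
have mRe := measurable_int _ aRe; have mIm := measurable_int _ aIm.
move: mRe mIm => /measurable_EFinP mRe /measurable_EFinP mIm.
apply/L2P; split; first by split.
rewrite /energy /sqnormc /=; under eq_integral do rewrite EFinD.
rewrite ge0_integralD//; last 4 first.
- by move=> x _; rewrite lee_fin sqr_ge0.
- exact/measurable_EFinP/measurable_funX.
- by move=> x _; rewrite lee_fin sqr_ge0.
- exact/measurable_EFinP/measurable_funX.
have f2 : (\int[mu]_x (sqnormc (f x))%:E < +oo)%E by move/L2P : Lf => [].
apply: lte_add_pinfty; apply: le_lt_trans f2.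
(* |f - t M s|^2 >= 0 for the real part, |f - i t M s|^2 >= 0 for the imaginary
   one *)
- apply: eRe => x t; rewrite -subr_ge0.
  rewrite [leRHS](_ : _ = sqnormc (f x - t%:C * (M x * s x))) ?sqnormc_ge0//.
  by rewrite /sqnormc /sqrt_phi !coordE/=; ring.
- apply: eIm => x t; rewrite -subr_ge0.
  rewrite [leRHS](_ : _ = sqnormc (f x - (0 +i* t) * (M x * s x))) ?sqnormc_ge0//.
  by rewrite /sqnormc /sqrt_phi !coordE/=; ring.
Qed.

Lemma mulH_E_phi M f : unit_weight M -> L2 mu f ->
  S_phi_adj_dom mu phi (fun x => conjc (M x) * f x) ->
  mulH mu sigma phi M
    (fun x => M x * E_phi mu sigma phi (fun y => conjc (M y) * f y) x).
Proof.
move=> uM Lf /(L2_S_phi_adj uM Lf) Lg; apply/mulHP; split.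
  exact: (cmeasurable_wcomp uM.1 Lg.1).
by eexists; [exact: Lg|exact: aeW].
Qed.

End weighted_composition.

Theorem corollary4p12 (R : realType) (d : measure_display)
    (X : measurableType d) (mu : probability X R)
    (sigma : {mfun X >-> X}) (phi : X -> R)
    (Lambda : countType) (m : Lambda -> X -> R[i])
    (hX : standard_borel R X)
    (hmu : nonatomic mu)
    (hsigma : range sigma = setT)
    (hqi : quasi_invariant mu sigma)
    (hphi : markovian mu sigma phi)
    (hphi_gt0 : \forall x \ae mu, 0 < phi x)
    (hm : forall i, cmeasurable (m i))
    (hm_orth : forall i j : Lambda,
       let g := fun x => sqrt_phi phi x * conjc (m j x) * m i x in
       S_phi_adj_dom mu phi g /\
       S_phi_adj mu sigma phi g = (fun=> (i == j)%:R) %[ae mu])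
    (hm_sum : forall f, L2 mu f ->
       (forall i, S_phi_adj_dom mu phi (fun x => conjc (m i x) * f x)) /\
       L2_has_sum mu
         (fun i x => m i x * E_phi mu sigma phi (fun y => conjc (m i y) * f y) x)
         f) :
  L2_orthogonal_direct_sum mu (fun i => mulH mu sigma phi (m i)).
Proof.
have mphi := hphi.1.
have weightP i j := is_pushed_density_cross_weight hqi
  (hm_orth i j).1 (hm_orth i j).2.
have unitM i : unit_weight mu sigma phi (m i).
  split=> //; have [+ _] := weightP i i; rewrite eqxx.
  by under eq_fun do rewrite Re_cross_weight_diag.
apply: L2_orthogonal_direct_sum_of_expansion
  => [i|i|i f g|i c f|i f g|i j ij f g|f Lf].
- exact: mulH_L2.
- exact: mulH0.
- exact: mulHD.
- exact: mulHZ.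
- exact: mulH_ae.
- have := weightP i j; rewrite (negbTE ij) => -[pRe pIm].
  exact: mulH_orthogonal.
- have [dom sumf] := hm_sum f Lf; eexists; last exact: sumf.
  by move=> i; exact: mulH_E_phi.
Qed.
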